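(* Almost all graphs $G$ have $rvd(G)=rvd(\overline{G})=n$; that is, the probability that the random graph $G=G(n,\frac12)$ satisfies $rvd(G)=rvd(\overline{G})=n$ tends to $1$ as $n\to\infty$.
   Context: $G(n,\frac12)$ is the random graph on $n$ vertices in which each edge is present independently with probability $\frac12$; $\overline{G}$ is the complement of $G$. The equality $rvd(G)=n$ is understood to include that $G$ is connected (and likewise for $\overline{G}$). All graphs are simple, finite and undirected. Let $G$ be a connected graph with at least two vertices whose vertices are colored (adjacent vertices may receive the same color). A set $X\subseteq V(G)$ is rainbow if no two vertices of $X$ have the same color. For two distinct vertices $x,y$ of $G$: if $x,y$ are nonadjacent, an $x$-$y$ rainbow vertex-cut is a rainbow set $S\subseteq V(G)\setminus\{x,y\}$ such that $x$ and $y$ belong to different components of $G-S$; if $x,y$ are adjacent, an $x$-$y$ rainbow vertex-cut is a set $S\subseteq V(G)\setminus\{x,y\}$ such that $x$ and $y$ belong to different components of $(G-xy)-S$ and at least one of $S\cup\{x\}$, $S\cup\{y\}$ is rainbow. The coloring is a rainbow vertex-disconnection coloring if every two distinct vertices $x,y$ of $G$ have an $x$-$y$ rainbow vertex-cut. The rainbow vertex-disconnection number $rvd(G)$ is the minimum number of colors in a rainbow vertex-disconnection coloring of $G$. *)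

(* Defs.v *)
From HB Require Import structures.
From mathcomp Require Import all_boot all_order all_algebra.

Set Implicit Arguments.
Unset Strict Implicit.
Unset Printing Implicit Defensive.

Definition vpairs (T : finType) : {set {set T}} := [set e : {set T} | #|e| == 2].

(* A simple graph on the vertex set T is given by its set of edges, each edge
   being a two-element set of vertices. *)
Record sgraph (T : finType) := SGraph {
  edges : {set {set T}};
  edges_vpairs : edges \subset vpairs T }.

HB.instance Definition _ (T : finType) := [isSub for @edges T].
HB.instance Definition _ (T : finType) := [Finite of sgraph T by <:].

Lemma compl_vpairs (T : finType) (G : sgraph T) :
  vpairs T :\: edges G \subset vpairs T.
Proof. exact: subsetDl. Qed.

Definition compl (T : finType) (G : sgraph T) : sgraph T :=
  SGraph (compl_vpairs G).

Definition adj (T : finType) (G : sgraph T) : rel T :=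
  [rel u v | [set u; v] \in edges G].

Definition gconnected (T : finType) (e : rel T) : bool :=
  [forall u, forall v, connect e u v].

Definition del_verts (T : finType) (e : rel T) (S : {set T}) : rel T :=
  [rel u v | [&& u \notin S, v \notin S & e u v]].

Definition del_edge (T : finType) (e : rel T) (x y : T) : rel T :=
  [rel u v | e u v && ([set u; v] != [set x; y])].

Definition rainbow (T : finType) (C : eqType) (c : T -> C) (X : {set T}) : bool :=
  [forall u in X, forall v in X, (u != v) ==> (c u != c v)].

(* For x, y outside S, the vertices x and y lie in different components of the
   graph with S deleted iff they are not related by connect (del_verts e S). *)
Definition rainbow_vertex_cut (T : finType) (C : eqType) (G : sgraph T)
    (c : T -> C) (x y : T) (S : {set T}) : bool :=
  (S \subset ~: [set x; y]) &&
  (if adj G x y then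
     ~~ connect (del_verts (del_edge (adj G) x y) S) x y
     && (rainbow c (x |: S) || rainbow c (y |: S))
   else
     ~~ connect (del_verts (adj G) S) x y && rainbow c S).

Definition rvd_coloring (T : finType) (C : eqType) (G : sgraph T)
    (c : T -> C) : bool :=
  [forall x, forall y, (x != y) ==>
     [exists S : {set T}, rainbow_vertex_cut G c x y S]].

Definition rvd_colorable (T : finType) (G : sgraph T) (k : nat) : bool :=
  [exists c : {ffun T -> 'I_k}, rvd_coloring G c].

Lemma rvd_colorable_ex (T : finType) (G : sgraph T) :
  exists k, rvd_colorable G k.
Proof.
exists #|T|; apply/existsP; exists [ffun x => enum_rank x].
have rb X : rainbow [ffun x : T => enum_rank x] X.
  apply/forall_inP=> u _; apply/forall_inP=> v _; apply/implyP.
  by apply: contraNN; rewrite !ffunE => /eqP/enum_rank_inj ->.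
apply/forallP=> x; apply/forallP=> y; apply/implyP=> neq_xy.
apply/existsP; exists (~: [set x; y]).
rewrite /rainbow_vertex_cut subxx !rb /= !andbT.
suff sep (e : rel T) : ~~ e x y -> (forall u, ~~ e u u) ->
    ~~ connect (del_verts e (~: [set x; y])) x y.
  have adjuu u : ~~ adj G u u.
    apply/negP=> /= /(fun H => subsetP (edges_vpairs G) _ H).
    by rewrite inE setUid cards1.
  case: ifP => Gxy; apply: sep => //.
  - by rewrite /del_edge /= eqxx andbF.
  - by move=> u; rewrite /del_edge /= negb_and adjuu.
  - by rewrite Gxy.
move=> nexy nee; apply/negP=> /connectP[p].
case: p => [|z p] /=; first by move=> _ xy; rewrite xy eqxx in neq_xy.
rewrite /del_verts /= !inE !negbK => /andP[/and3P[_ /orP[]/eqP-> exz] _] _.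
  by rewrite (negbTE (nee x)) in exz.
by rewrite (negbTE nexy) in exz.
Qed.

Definition rvd (T : finType) (G : sgraph T) : nat :=
  ex_minn (rvd_colorable_ex G).

(* rvd is a total function here, but the invariant is only meaningful for
   connected graphs with at least two vertices; has_rvd records both. *)
Definition has_rvd (T : finType) (G : sgraph T) (k : nat) : bool :=
  [&& 1 < #|T|, gconnected (adj G) & rvd G == k].

From mathcomp Require Import all_classical all_reals all_analysis.
Import Order.TTheory GRing.Theory Num.Theory.

Local Open Scope ring_scope.

(* The law of the random graph on T in which each pair of vertices is an edge
   independently with probability p. *)
Definition gnp_mass (R : realType) (T : finType) (p : R) (G : sgraph T) : R :=
  \prod_(e in vpairs T) (if e \in edges G then p else 1 - p).

Definition gnp_prob (R : realType) (T : finType) (p : R)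
    (A : pred (sgraph T)) : R :=
  \sum_(G : sgraph T | A G) gnp_mass p G.

Lemma gnp_prob_predT (R : realType) (T : finType) (p : R) :
  @gnp_prob R T p predT = 1.
Proof.
pose w (E : {set {set T}}) : R :=
  \prod_(e : {set T}) (if e \in E then (if e \in vpairs T then p else 0)
                       else (if e \in vpairs T then 1 - p else 1)).
have w_out (E : {set {set T}}) : ~~ (E \subset vpairs T) -> w E = 0.
  case/fintype.subsetPn=> e eE eV; rewrite /w (bigD1 e) //= eE (negbTE eV).
  by rewrite mul0r.
have massE (G : sgraph T) : gnp_mass p G = w (edges G).
  rewrite /gnp_mass /w big_mkcond; apply: eq_bigr => e _ /=.
  case: (boolP (e \in vpairs T)) => // eV.
  by rewrite (contraNF (fintype.subsetP (edges_vpairs G) e) eV).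
transitivity (\sum_(E : {set {set T}}) w E).
  rewrite (bigID (fun E : {set {set T}} => E \subset vpairs T)) /=.
  rewrite [X in _ + X]big1 ?addr0; last by move=> E; apply: w_out.
  rewrite (reindex_omap (@edges T) insub) /=; last first.
    by move=> E EV; rewrite insubT.
  apply: eq_big => [G|G _]; last exact: massE.
  by rewrite edges_vpairs [insub _](valK G) eqxx.
transitivity (\prod_(e : {set T}) ((if e \in vpairs T then p else 0)
    + (if e \in vpairs T then 1 - p else 1))).
  by rewrite bigA_distr.
apply: big1 => e _.
by case: ifP => _; rewrite ?add0r // addrC subrK.
Qed.

(* Main.v *)
Require Import Defs.
From mathcomp Require Import all_boot all_order all_algebra.
From mathcomp Require Import all_classical all_reals all_analysis.
From mathcomp Require Import ring lra zify.
Import numFieldNormedType.Exports.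
Import Order.TTheory GRing.Theory Num.Theory.

(** Two distinct vertices u, v with two distinct common neighbours x, y must
    have different colors in every rainbow vertex-disconnection coloring: both
    u and v lie on a path of length two from x to y, so both belong to every
    x-y cut, and an x-y rainbow vertex-cut is a rainbow set.  Hence, if any two
    distinct vertices have at least two common neighbours, then the graph is
    connected and every such coloring is injective, whence rvd(G) = |V(G)|
    ([codeg2_has_rvd]); the upper bound holds for every graph, since any
    injective coloring is admissible.

    It remains to see that almost all graphs and their complements have this
    property.  If it fails for u, v, then for some w the vertices u and v have
    no common neighbour outside {u, v, w}.  For fixed u, v, w with u <> v this
    has probability at most (1 - p^2)^(n - 3) ([gnp_prob_no_cnbr]), and there
    are at most n^3 triples ([gnp_prob_not_codeg2]).  Complementation turns
    edge probability p into 1 - p ([gnp_prob_compl]), so for p = 1/2 the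
    failure probability for G or its complement is at most
    2 n^3 (3/4)^(n - 3), which is O(1/n) ([cubic_geometric_bound]). *)

Set Implicit Arguments.
Unset Strict Implicit.
Unset Printing Implicit Defensive.
Local Open Scope ring_scope.

(** * Graphs in which any two vertices have two common neighbours *)

(** The set of common neighbours of [u] and [v]. *)
Definition cnbr (T : finType) (G : sgraph T) (u v : T) : {set T} :=
  [set x | adj G u x && adj G v x].

(** Any two distinct vertices have at least two common neighbours. *)
Definition codeg2 (T : finType) (G : sgraph T) : bool :=
  [forall u, forall v, (u != v) ==> (1 < #|cnbr G u v|)%N].

Lemma adjC (T : finType) (G : sgraph T) (u v : T) : adj G u v = adj G v u.
Proof. by rewrite /adj /= finset.setUC. Qed.

Lemma adj_irr (T : finType) (G : sgraph T) (u : T) : adj G u u = false.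
Proof.
apply/negP => /= /(fintype.subsetP (edges_vpairs G)).
by rewrite inE finset.setUid cards1.
Qed.

Lemma cut_contains_cnbr (T : finType) (C : eqType) (G : sgraph T) (c : T -> C)
    (x y : T) (S : {set T}) :
  rainbow_vertex_cut G c x y S -> cnbr G x y \subset S.
Proof.
case/andP => /fintype.subsetP sS H; apply/fintype.subsetP => u.
rewrite inE => /andP[xu yu]; apply/negPn/negP => uS.
have xS : x \notin S by apply/negP => /sS; rewrite !inE eqxx.
have yS : y \notin S by apply/negP => /sS; rewrite !inE eqxx orbT.
have ux : u != x by apply: contraTneq xu => ->; rewrite adj_irr.
have uy : u != y by apply: contraTneq yu => ->; rewrite adj_irr.
have path2 (e : rel T) : e x u -> e u y -> connect (del_verts e S) x y.
  move=> exu euy; apply: (@connect_trans _ _ u); apply: connect1;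
  by rewrite /del_verts /= ?xS ?uS ?yS.
(* The path x, u, y avoids the edge xy, so it survives when that edge is deleted. *)
have uxy : u \notin [set x; y] by rewrite !inE negb_or ux uy.
have neq z : [set z; u] != [set x; y].
  by apply: contraNneq uxy => <-; rewrite !inE eqxx orbT.
move: H; case: ifP => _ /andP[/negP + _]; apply; apply: path2 => //.
- by rewrite /del_edge /= neq andbT.
- by rewrite /del_edge /= adjC [[set u; y]]finset.setUC neq andbT.
- by rewrite adjC.
Qed.

Lemma cut_rainbow (T : finType) (C : eqType) (G : sgraph T) (c : T -> C)
    (x y : T) (S : {set T}) (u v : T) :
  rainbow_vertex_cut G c x y S -> u \in S -> v \in S -> u != v -> c u != c v.
Proof.
case/andP => _ H uS vS uv.
have sub (X : {set T}) : S \subset X -> rainbow c X -> c u != c v.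
  move=> /fintype.subsetP sX /forall_inP/(_ u (sX _ uS))/forall_inP/(_ v (sX _ vS)).
  by rewrite uv.
move: H; case: ifP => _ /andP[_]; last exact: sub.
by case/orP; apply: sub; apply: finset.subsetUr.
Qed.

Lemma codeg2_connected (T : finType) (G : sgraph T) :
  codeg2 G -> gconnected (adj G).
Proof.
move=> HG; apply/forallP => u; apply/forallP => v.
have [->|uv] := eqVneq u v; first exact: connect0.
move/forallP/(_ u)/forallP/(_ v): HG; rewrite uv => /ltnW/card_gt0P[x].
rewrite inE => /andP[ux vx].
by apply: (@connect_trans _ _ x); apply: connect1 => //; rewrite adjC.
Qed.

Lemma codeg2_coloring_inj (T : finType) (C : eqType) (G : sgraph T)
    (c : T -> C) :
  codeg2 G -> rvd_coloring G c -> injective c.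
Proof.
move=> HG Hc u v; apply: contra_eq => uv.
move/forallP/(_ u)/forallP/(_ v): HG; rewrite uv => /card_gt1P[x [y [xA yA xy]]].
move/forallP/(_ x)/forallP/(_ y): Hc; rewrite xy => /existsP[S HS].
move: xA yA; rewrite !inE => /andP[ux vx] /andP[uy vy].
have /fintype.subsetP sS := cut_contains_cnbr HS.
by apply: (cut_rainbow HS) => //; apply: sS; rewrite inE !(adjC G _ u, adjC G _ v) ?ux ?vx.
Qed.

(** The set of all vertices other than [x] and [y] is an [x]-[y] cut, and every
    set is rainbow for an injective coloring. *)
Lemma inj_rvd_coloring (T : finType) (C : eqType) (G : sgraph T) (c : T -> C) :
  injective c -> rvd_coloring G c.
Proof.
move=> c_inj; apply/forallP=> x; apply/forallP=> y; apply/implyP=> xy.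
apply/existsP; exists (~: [set x; y]).
have rb (X : {set T}) : rainbow c X.
  apply/forall_inP=> u _; apply/forall_inP=> v _; apply/implyP.
  by apply: contraNN => /eqP/c_inj ->.
rewrite /rainbow_vertex_cut subxx !rb /= !andbT.
have sep (e : rel T) : ~~ e x x -> ~~ e x y ->
    ~~ connect (del_verts e (~: [set x; y])) x y.
  move=> exx exy; apply/negP=> /connectP[[|z p] /=].
    by move=> _ yx; rewrite yx eqxx in xy.
  rewrite /del_verts /= !inE !negbK => /andP[/and3P[_ /orP[]/eqP-> exz] _] _.
    by rewrite exz in exx.
  by rewrite exz in exy.
case: ifP => Gxy; apply: sep; rewrite ?Gxy ?adj_irr //.
- by rewrite /del_edge /= adj_irr.
- by rewrite /del_edge /= eqxx andbF.
Qed.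

Lemma codeg2_has_rvd (T : finType) (G : sgraph T) :
  (1 < #|T|)%N -> codeg2 G -> has_rvd G #|T|.
Proof.
move=> T1 HG; rewrite /has_rvd T1 codeg2_connected //= /rvd.
case: ex_minnP => k /existsP[c Hc] kmin; rewrite eqn_leq; apply/andP; split.
  apply: kmin; apply/existsP; exists [ffun x => enum_rank x].
  by apply: inj_rvd_coloring => x y; rewrite !ffunE => /enum_rank_inj.
by rewrite -[k in (_ <= k)%N]card_ord; apply: leq_card (codeg2_coloring_inj HG Hc).
Qed.

(** A failure of [codeg2] is witnessed by a triple [(u, v, w)]: the set of common
    neighbours of [u] and [v] is contained in [[set w]].  When that set is empty
    the choice of [w] is irrelevant. *)
Lemma not_codeg2P (T : finType) (G : sgraph T) :
  (0 < #|T|)%N -> ~~ codeg2 G ->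
  exists t : T * T * T, (t.1.1 != t.1.2) &&
    [disjoint cnbr G t.1.1 t.1.2 & ~: [set t.1.1; t.1.2; t.2]].
Proof.
move=> T0; rewrite negb_forall => /existsP[u]; rewrite negb_forall => /existsP[v].
rewrite negb_imply -leqNgt => /andP[uv /card_le1_eqP H].
suff [w Hw] : exists w, cnbr G u v \subset [set w].
  exists (u, v, w); rewrite uv /= disjoint_subset.
  apply/fintype.subsetP => x /(fintype.subsetP Hw); rewrite !inE => ->.
  by rewrite orbT.
have [->|[w wG]] := set_0Vmem (cnbr G u v).
  by exists u; apply: finset.sub0set.
by exists w; apply/fintype.subsetP => x xG; rewrite inE; apply/eqP/H.
Qed.

(** * Probabilities in the random graph *)

Lemma gnp_mass_ge0 (R : realType) (T : finType) (p : R) (G : sgraph T) :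
  0 <= p <= 1 -> 0 <= gnp_mass p G.
Proof.
by move=> /andP[p0 p1]; apply: prodr_ge0 => e _; case: ifP; rewrite ?subr_ge0.
Qed.

Lemma le_gnp_prob (R : realType) (T : finType) (p : R) (A B : pred (sgraph T)) :
  0 <= p <= 1 -> (forall G, A G -> B G) -> gnp_prob p A <= gnp_prob p B.
Proof.
move=> p01 AB; rewrite /gnp_prob big_mkcond [leRHS]big_mkcond /=.
apply: ler_sum => G _; case: (boolP (A G)) => [/AB -> //|_].
by case: ifP => // _; apply: gnp_mass_ge0.
Qed.

Lemma gnp_prob_split (R : realType) (T : finType) (p : R)
    (A B : pred (sgraph T)) :
  gnp_prob p A = gnp_prob p (predI A B) + gnp_prob p (predI A (predC B)).
Proof. by rewrite /gnp_prob (bigID B). Qed.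

Lemma gnp_prob_union_bound (R : realType) (T I : finType) (p : R)
    (A : pred (sgraph T)) (P : pred I) (B : I -> pred (sgraph T)) :
  0 <= p <= 1 -> (forall G, A G -> exists2 i, P i & B i G) ->
  gnp_prob p A <= \sum_(i | P i) gnp_prob p (B i).
Proof.
move=> p01 AB; rewrite /gnp_prob.
under [leRHS]eq_bigr do rewrite big_mkcond.
rewrite exchange_big /= big_mkcond /=; apply: ler_sum => G _.
have ge0 (i : I) : 0 <= (if B i G then gnp_mass p G else 0).
  by case: ifP => // _; apply: gnp_mass_ge0.
case: ifP => [/AB[i Pi BiG]|_]; last by apply: sumr_ge0.
by rewrite (bigD1 i) //= BiG lerDl; apply: sumr_ge0.
Qed.

(** All pairs of [D] are edges with probability [p ^+ #|D|].  The sum over graphs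
    is extended to all families [E] of vertex sets by giving weight zero to the
    families that do not lie between [D] and [vpairs T]; distributivity then
    turns it into a product over single sets. *)
Lemma gnp_prob_subset (R : realType) (T : finType) (p : R) (D : {set {set T}}) :
  D \subset vpairs T ->
  gnp_prob p (fun G => D \subset edges G) = p ^+ #|D|.
Proof.
move=> /fintype.subsetP DV.
pose F (e : {set T}) : R := if e \in vpairs T then p else 0.
pose H (e : {set T}) : R :=
  if e \in D then 0 else if e \in vpairs T then 1 - p else 1.
pose w (E : {set {set T}}) : R := \prod_e (if e \in E then F e else H e).
have w_out (E : {set {set T}}) : ~~ (E \subset vpairs T) -> w E = 0.
  case/fintype.subsetPn=> e eE eV.
  by rewrite /w (bigD1 e) //= eE /F (negbTE eV) mul0r.
have w_D (E : {set {set T}}) : ~~ (D \subset E) -> w E = 0.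
  case/fintype.subsetPn=> e eD eE.
  by rewrite /w (bigD1 e) //= (negbTE eE) /H eD mul0r.
have massE (G : sgraph T) : D \subset edges G -> gnp_mass p G = w (edges G).
  move=> /fintype.subsetP DG; rewrite /gnp_mass /w big_mkcond; apply: eq_bigr => e _.
  rewrite /F /H; case: (boolP (e \in edges G)) => eG.
    by rewrite (fintype.subsetP (edges_vpairs G) e eG).
  by rewrite (contraNF (DG e) eG).
transitivity (\sum_(E : {set {set T}}) w E).
  rewrite (bigID (fun E : {set {set T}} => E \subset vpairs T)) /=.
  rewrite [X in _ + X]big1 ?addr0; last by move=> E; apply: w_out.
  rewrite (reindex_omap (@edges T) insub) /=; last first.
    by move=> E EV; rewrite insubT.
  rewrite /gnp_prob big_mkcond /= [RHS]big_mkcond /=; apply: eq_bigr => G _.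
  rewrite edges_vpairs [insub _](valK G) eqxx /=.
  by case: ifPn => [/massE //|/w_D ->].
transitivity (\prod_(e : {set T}) (F e + H e)); first by rewrite bigA_distr.
rewrite -prodr_const [RHS]big_mkcond /=; apply: eq_bigr => e _.
rewrite /F /H; case: (boolP (e \in D)) => [/DV ->|_]; first by rewrite addr0.
by case: ifP => _; rewrite ?add0r // addrC subrK.
Qed.

Lemma pair_in_vpairs (T : finType) (u v : T) : u != v -> [set u; v] \in vpairs T.
Proof. by move=> uv; rewrite inE cards2 uv. Qed.

Lemma neq_set2 (T : finType) (a b c d : T) :
  b != c -> b != d -> [set a; b] != [set c; d].
Proof.
move=> bc bd; apply/eqP => /finset.setP/(_ b).
by rewrite !inE eqxx orbT (negbTE bc) (negbTE bd).
Qed.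

(** The set [D] of prescribed edges makes the induction on [s] go through: the
    event that [x] is not a common neighbour of [u] and [v] is the complement of
    the event that both [[set u; x]] and [[set v; x]] are edges, and these two
    pairs can be added to [D]. *)
Lemma gnp_prob_no_cnbr_aux (R : realType) (T : finType) (p : R) (u v : T)
    (s : seq T) (D : {set {set T}}) :
  u != v -> uniq s -> u \notin s -> v \notin s -> D \subset vpairs T ->
  (forall x, x \in s -> ([set u; x] \notin D) && ([set v; x] \notin D)) ->
  gnp_prob p (fun G => all [pred x | x \notin cnbr G u v] s
                       && (D \subset edges G)) =
  (1 - p ^+ 2) ^+ size s * p ^+ #|D|.
Proof.
move=> uv; elim: s D => [|x s IHs] D.
  by move=> _ _ _ DV _; rewrite expr0 mul1r -gnp_prob_subset.
rewrite cons_uniq !inE !negb_or.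
move=> /andP[xs us] /andP[ux uNs] /andP[vx vNs] DV sD.
have /andP[uxD vxD] := sD x (mem_head x s).
have sD' y : y \in s -> ([set u; y] \notin D) && ([set v; y] \notin D).
  by move=> ys; apply: sD; rewrite inE ys orbT.
pose D2 := [set u; x] |: ([set v; x] |: D).
have ux_vx : [set u; x] != [set v; x].
  by rewrite eq_sym [[set v; x]]finset.setUC neq_set2 // eq_sym.
have cardD2 : #|D2| = (#|D| + 2)%N.
  by rewrite !cardsU1 !inE negb_or ux_vx uxD vxD addn2 !add1n.
have D2V : D2 \subset vpairs T.
  by rewrite !finset.subUset !finset.sub1set !pair_in_vpairs.
have sD2 y : y \in s -> ([set u; y] \notin D2) && ([set v; y] \notin D2).
  move=> ys; have /andP[uyD vyD] := sD' y ys.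
  have yx : y != x by apply: contraNneq xs => <-.
  have yu : y != u by apply: contraNneq uNs => <-.
  have yv : y != v by apply: contraNneq vNs => <-.
  by rewrite !inE !negb_or uyD vyD !neq_set2.
have := gnp_prob_split p
  (fun G => all [pred y | y \notin cnbr G u v] s && (D \subset edges G))
  (fun G => x \in cnbr G u v).
rewrite (IHs D) // => IHD.
have := IHs D2 us uNs vNs D2V sD2.
rewrite cardD2 exprD => IHD2.
transitivity ((1 - p ^+ 2) ^+ size s * p ^+ #|D|
              - (1 - p ^+ 2) ^+ size s * (p ^+ #|D| * p ^+ 2)); last first.
  by rewrite /= [_ ^+ (size s).+1]exprSr -mulrA mulrBl mul1r mulrBr [p ^+ 2 * _]mulrC.
rewrite -IHD2 IHD [X in _ = X + _ - _](_ : _ = gnp_prob p (fun G =>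
  all [pred y | y \notin cnbr G u v] s && (D2 \subset edges G))).
  rewrite addrAC subrr add0r; apply: eq_bigl => G /=.
  by rewrite -andbA andbC.
apply: eq_bigl => G /=; rewrite !finset.subUset !finset.sub1set inE /adj /=.
by rewrite -!andbA; do !bool_congr.
Qed.

Lemma gnp_prob_no_cnbr (R : realType) (T : finType) (p : R) (u v : T)
    (X : {set T}) :
  u != v -> u \notin X -> v \notin X ->
  gnp_prob p (fun G => [disjoint cnbr G u v & X]) = (1 - p ^+ 2) ^+ #|X|.
Proof.
move=> uv uX vX.
have := @gnp_prob_no_cnbr_aux R T p u v (enum X) finset.set0 uv (enum_uniq _).
rewrite !mem_enum finset.sub0set cards0 expr0 mulr1 -cardE => <- //; last first.
  by move=> x _; rewrite !inE.
apply: eq_bigl => G; rewrite finset.sub0set andbT disjoint_sym disjoint_subset.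
by apply/fintype.subsetP/allP => H x; [rewrite mem_enum|rewrite -mem_enum] => /H.
Qed.

(** The exponent uses truncated subtraction, which is harmless as the base is at
    most 1. *)
Lemma gnp_prob_not_codeg2 (R : realType) (T : finType) (p : R) :
  0 <= p <= 1 -> (0 < #|T|)%N ->
  gnp_prob p (fun G : sgraph T => ~~ codeg2 G)
    <= #|T|%:R ^+ 3 * (1 - p ^+ 2) ^+ (#|T| - 3).
Proof.
move=> p01 T0; have /andP[p0 p1] := p01.
have q0 : 0 <= 1 - p ^+ 2 by rewrite subr_ge0 exprn_ile1.
have q1 : 1 - p ^+ 2 <= 1 by rewrite lerBlDr lerDl sqr_ge0.
apply: (le_trans (@gnp_prob_union_bound R T (T * T * T)%type p _
  (fun t => t.1.1 != t.1.2)
  (fun t G => [disjoint cnbr G t.1.1 t.1.2 & ~: [set t.1.1; t.1.2; t.2]])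
  p01 _)).
  by move=> G /(not_codeg2P T0)[t /andP[? ?]]; exists t.
apply: (@le_trans _ _ (\sum_(t : T * T * T) (1 - p ^+ 2) ^+ (#|T| - 3))); last first.
  rewrite sumr_const !card_prod -!natrX -[leLHS]mulr_natl.
  by rewrite !expnS expn0 muln1 mulnA.
rewrite big_mkcond /=; apply: ler_sum => -[[u v] w] _ /=.
case: ifP => [uv|_]; last exact: exprn_ge0.
rewrite gnp_prob_no_cnbr ?inE ?eqxx ?orbT //.
apply: ler_wiXn2l => //; rewrite cardsCs finset.setCK leq_sub2l //.
by rewrite (leq_trans (leq_card_setU _ _)) // cards1 addn1 cards2 ltnS; case: eqP.
Qed.

(** * Complementation *)

Lemma complK (T : finType) : involutive (@compl T).
Proof.
move=> G; apply: val_inj => /=; rewrite finset.setDDr finset.setDv finset.set0U.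
exact/finset.setIidPr/edges_vpairs.
Qed.

Lemma gnp_mass_compl (R : realType) (T : finType) (p : R) (G : sgraph T) :
  gnp_mass p (compl G) = gnp_mass (1 - p) G.
Proof.
apply: eq_bigr => e eV; rewrite !inE; rewrite inE in eV; rewrite eV andbT.
by case: ifP => [/negbTE ->|/negbFE ->]; rewrite // subKr.
Qed.

Lemma gnp_prob_compl (R : realType) (T : finType) (p : R)
    (A : pred (sgraph T)) :
  gnp_prob p (fun G => A (compl G)) = gnp_prob (1 - p) A.
Proof.
rewrite /gnp_prob [RHS](reindex_inj (inv_inj (@complK T))) /=.
by apply: eq_bigr => G _; rewrite gnp_mass_compl subKr.
Qed.

(** * The probability bound and its limit *)

Lemma gnp_prob_rvd_card (R : realType) (T : finType) :
  (1 < #|T|)%N ->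
  1 - 2 * (#|T|%:R ^+ 3 * (3 / 4) ^+ (#|T| - 3))
  <= gnp_prob (2^-1 : R)
       (fun G : sgraph T => has_rvd G #|T| && has_rvd (compl G) #|T|) <= 1.
Proof.
move=> T1; have h01 : 0 <= (2^-1 : R) <= 1 by lra.
set A := fun G => _; apply/andP; split; last first.
  by rewrite -[leRHS](gnp_prob_predT T (2^-1 : R)) le_gnp_prob.
rewrite lerBlDr -[leLHS](gnp_prob_predT T (2^-1 : R)) (gnp_prob_split _ _ A).
rewrite lerD ?le_gnp_prob //=.
have bad := @gnp_prob_not_codeg2 R T _ h01 (ltnW T1).
rewrite (_ : 1 - 2^-1 ^+ 2 = 3 / 4 :> R) in bad; last by field.
have badC : gnp_prob (2^-1 : R) (fun G : sgraph T => ~~ codeg2 (compl G))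
    <= #|T|%:R ^+ 3 * (3 / 4) ^+ (#|T| - 3).
  rewrite (gnp_prob_compl _ (fun G => ~~ codeg2 G)) (_ : 1 - 2^-1 = 2^-1) //.
  by field.
rewrite mulr_natl mulr2n; apply: le_trans (lerD bad badC).
apply: le_trans (_ : _ <= \sum_(b : bool) gnp_prob (2^-1 : R)
  (fun G : sgraph T => ~~ codeg2 (if b then G else compl G))) _; last first.
  by rewrite big_bool.
apply: gnp_prob_union_bound => // G.
rewrite /= /A negb_and => /orP[] H; [exists true | exists false] => //=;
by apply: contraNN H; apply: codeg2_has_rvd.
Qed.

(** A single term of the binomial expansion of [(1 + x) ^+ m]. *)
Lemma expr_ge_bin (R : realType) (x : R) (m k : nat) :
  0 <= x -> 'C(m, k)%:R * x ^+ k <= (1 + x) ^+ m.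
Proof.
move=> x0; have [mk|km] := ltnP m k.
  by rewrite bin_small // mul0r exprn_ge0 // addr_ge0.
rewrite exprDn (bigD1 (inord k)) //= inordK ?ltnS // expr1n mul1r mulr_natl lerDl.
by apply: sumr_ge0 => i _; rewrite expr1n mul1r mulrn_wge0 // exprn_ge0.
Qed.

(** The exponential decay comes from the term of degree 4 in the expansion of
    [(1 + 1/3) ^+ (n + 4)], since [(n + 1) ^ 4 <= 4`! * 'C(n + 4, 4)].  The factor
    [(4 / 3) ^+ 7] compensates the exponents [n + 4] and [n - 3]; it also covers
    the truncated case [n < 3]. *)
Lemma cubic_geometric_bound (R : realType) (n : nat) :
  (n%:R : R) ^+ 3 * (3 / 4) ^+ (n - 3)
  <= (4`! * 3 ^ 4)%:R * (4 / 3) ^+ 7 * n.+1%:R^-1.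
Proof.
rewrite ler_pdivlMr ?ltr0Sn //.
have q0 : 0 < (3 / 4 : R) by lra.
apply: (@le_trans _ _ ((n.+1 ^ 4)%:R * (3 / 4) ^+ (n - 3))).
  rewrite mulrAC ler_pM2r ?exprn_gt0 // -natrX -natrM ler_nat [leqRHS]expnSr.
  by rewrite leq_mul2r leq_exp2r // leqnSn orbT.
have binP : ((n.+1 ^ 4)%:R : R) <= (4`! * 3 ^ 4)%:R * (4 / 3) ^+ (n + 4).
  apply: (@le_trans _ _ ((4`! * 'C(n + 4, 4))%:R)).
    rewrite ler_nat mulnC bin_ffact !ffactnS ffactn0 muln1 !expnS expn0 muln1.
    by rewrite !addnS addn0 /=; apply: leq_mul; [|apply: leq_mul; [|apply: leq_mul]]; lia.
  have := @expr_ge_bin R 3^-1 (n + 4) 4.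
  rewrite (_ : 1 + 3^-1 = 4 / 3 :> R); last by field.
  rewrite exprVn ler_pdivrMr ?exprn_gt0 // => H.
  rewrite [leLHS]natrM [(4`! * 3 ^ 4)%:R]natrM -mulrA ler_pM2l ?ltr0n //.
  by rewrite [leRHS]mulrC natrX; apply: H; rewrite invr_ge0.
apply: le_trans (ler_wpM2r _ binP) _; first by rewrite exprn_ge0 // ltW.
rewrite -mulrA ler_pM2l ?ltr0n //.
rewrite (_ : (3 / 4 : R) = (4 / 3)^-1) ?exprVn; last by field.
have p0 : 0 < (4 / 3 : R) by lra.
rewrite ler_pdivrMr ?exprn_gt0 // -exprD.
by apply: ler_weXn2l; [lra | lia].
Qed.

Local Open Scope classical_set_scope.

Theorem theorem5p4 (R : realType) :
  gnp_prob (2^-1 : R)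
    (fun G : sgraph 'I_n => has_rvd G n && has_rvd (compl G) n)
    @[n --> \oo] --> (1 : R).
Proof.
pose K : R := 2 * ((4`! * 3 ^ 4)%:R * (4 / 3) ^+ 7).
apply: (@squeeze_cvgr _ _ _ _ (fun n => 1 - K * harmonic n) (fun=> 1)).
- near=> n.
  have n1 : (1 < n)%N by near: n; exact: nbhs_infty_gt.
  have := @gnp_prob_rvd_card R 'I_n; rewrite card_ord => /(_ n1)/andP[lb ->].
  rewrite andbT; apply: le_trans lb; apply: lerB => //.
  rewrite /K -[leRHS]mulrA ler_pM2l //.
  exact: cubic_geometric_bound.
- rewrite -[X in _ --> X]subr0 -[X in _ - X](mulr0 K).
  by apply: cvgB; [exact: cvg_cst | apply: cvgM; [exact: cvg_cst | exact: cvg_harmonic]].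
- exact: cvg_cst.
Unshelve. all: by end_near.
Qed.
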